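(* For the path $P_n$ of order $n\ge 1$, $$IC(P_n)=\begin{cases} n & \text{if } n\le 4;\\ 4 & \text{if } n=5;\\ 5 & \text{if } n=6,7,8,9;\\ 6 & \text{if } n\ge 10.\end{cases}$$
   Context: Graphs are finite and simple. $P_n$ denotes the path with $n$ vertices. A set $S$ of vertices is dominating if every vertex is in $S$ or adjacent to a vertex of $S$; it is independent if its vertices are pairwise nonadjacent; an independent dominating set is a set that is both independent and dominating. An independent coalition in $G$ consists of two disjoint independent sets of vertices $V_1,V_2$, neither of which is an independent dominating set but whose union $V_1\cup V_2$ is an independent dominating set; one says that $V_1$ and $V_2$ form an independent coalition. An $ic$-partition of $G$ is a partition $\pi=\{V_1,\dots,V_k\}$ of $V(G)$ into nonempty sets such that every $V_i\in\pi$ either is a singleton dominating set (a dominating set of cardinality 1), or is not an independent dominating set but forms an independent coalition with another set $V_j\in\pi$. The independent coalition number $IC(G)$ is the maximum number of classes of an $ic$-partition of $G$; the assertion $IC(G)=t$ includes that $G$ has an $ic$-partition. *)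

(* Defs.v *)
From mathcomp Require Import all_boot.

Set Implicit Arguments.
Unset Strict Implicit.
Unset Printing Implicit Defensive.

Record sgraph := SGraph {
  vertex :> finType;
  edge : rel vertex;
  edge_sym : symmetric edge;
  edge_irrefl : irreflexive edge
}.

Section IndependentCoalition.
Variable G : sgraph.
Implicit Types (S A B : {set G}) (P : {set {set G}}).

Definition dominating S : bool :=
  [forall v : G, (v \in S) || [exists u in S, edge v u]].

Definition independent S : bool :=
  [forall u in S, forall v in S, ~~ edge u v].

Definition independent_dominating S : bool := independent S && dominating S.

Definition independent_coalition A B : bool :=
  [&& [disjoint A & B],
      independent A, independent B,
      ~~ independent_dominating A, ~~ independent_dominating B
    & independent_dominating (A :|: B)].

Definition singleton_dominating S : bool := (#|S| == 1) && dominating S.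

(* [partition] already requires the classes to be nonempty. *)
Definition ic_partition P : bool :=
  partition P [set: G] &&
  [forall A in P,
     singleton_dominating A ||
     ~~ independent_dominating A &&
     [exists B in P, (B != A) && independent_coalition A B]].

(* IC(G) = t as a relation, since a graph may have no ic-partition. *)
Definition IC_is (t : nat) : Prop :=
  (exists2 P, ic_partition P & #|P| = t) /\
  (forall P, ic_partition P -> #|P| <= t).

End IndependentCoalition.

Definition path_edge (n : nat) : rel 'I_n :=
  fun i j => (i.+1 == j :> nat) || (j.+1 == i :> nat).

Lemma path_edge_sym n : symmetric (@path_edge n).
Proof. by move=> i j; rewrite /path_edge orbC. Qed.

Lemma path_edge_irrefl n : irreflexive (@path_edge n).
Proof. by move=> i; rewrite /path_edge orbb; apply/negbTE; rewrite eqn_leq ltnn. Qed.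

Definition path_graph (n : nat) : sgraph :=
  SGraph (@path_edge_sym n) (@path_edge_irrefl n).

(* Main.v *)
Require Import Defs.
From mathcomp Require Import all_boot zify.

Set Implicit Arguments.
Unset Strict Implicit.
Unset Printing Implicit Defensive.

(** Call a class seen by a vertex v when it meets the closed neighbourhood N[v].
If two classes form a coalition, their union dominates, so every vertex sees at
least one of them.

Upper bound. Let n >= 4; then no single vertex dominates, so every class has a
partner. Let a and b be the classes of an end vertex and of its neighbour. The
end vertex sees only a and b, and a, b are not partners, so every coalition
consists of one of a, b and a third class: all classes other than a, b are
partners of a or of b ([leaf_hitting]). No class of a coalition dominates, so
some vertex v does not see a; it then sees all the partners of a. It sees at
most three classes. If it misses b as well, it sees the partners of both, and
there are at most 2 + 3 classes. Hence with six classes or more v sees b, so a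
has at most two partners; likewise b. So there are exactly six classes, the
partners of a and those of b are disjoint pairs, and N[v] consists of one vertex
of b and one of each partner of a ([hitting_extremal]). Vertices missing b
behave in the same way with the roles exchanged. If v misses a, w misses b and
v, w are as close as possible, the rigid colours around them leave too little
room on a path with fewer than ten vertices ([forced_gap_length]). For n = 5,
five classes would be singletons, and no vertex can be the partner of the middle
one, since it would have to dominate both ends.

Lower bound. For n <= 3 the singletons form a partition as required. For larger
n, the words 0123, 012340 and 0123104501 give colourings of the paths with 4, 6
and 10 vertices. Repeating the second letter of a word in front of it creates no
new set of colours on a closed neighbourhood or on an edge, so each word extends
to all longer paths with the same number of classes ([zigzag_paired]). *)

(** * Classes seen by a vertex, and coalitions around a leaf *)

Section Seen.
Variables (G : sgraph) (P : {set {set G}}).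

Definition cnbhd (v : G) : {set G} := [set u | (u == v) || edge v u].

Definition seen (v : G) : {set {set G}} := pblock P @: cnbhd v.

Definition partners (A : {set G}) : {set {set G}} :=
  [set X in P | independent_coalition A X].

(** Closed neighbourhoods make domination a single hitting condition. *)
Lemma dominatingP (S : {set G}) :
  reflect (forall v, exists2 u, u \in cnbhd v & u \in S) (dominating S).
Proof.
apply: (iffP forallP) => domS v.
  have /orP[vS|/exists_inP[u uS uv]] := domS v.
    by exists v; rewrite // inE eqxx.
  by exists u; rewrite // inE uv orbT.
have [u] := domS v; rewrite inE => /orP[/eqP->->//|vu uS].
by apply/orP; right; apply/exists_inP; exists u.
Qed.

Lemma coalition_sym (A B : {set G}) :
  independent_coalition A B = independent_coalition B A.
Proof.
rewrite /independent_coalition disjoint_sym setUC.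
by do !bool_congr.
Qed.

Hypothesis partP : partition P [set: G].

Let tiP : trivIset P := partition_trivIset partP.

Lemma pblock_in v : pblock P v \in P.
Proof. by apply: pblock_mem; rewrite (cover_partition partP). Qed.

Lemma mem_own_pblock v : v \in pblock P v.
Proof. by rewrite mem_pblock (cover_partition partP). Qed.

Lemma partition_pblocks : P = pblock P @: [set: G].
Proof.
apply/setP=> A; apply/idP/imsetP => [PA|[v _ ->]]; last exact: pblock_in.
have /set0Pn[v Av] := partition_neq0 partP PA.
by exists v; rewrite ?(def_pblock tiP PA Av).
Qed.

Lemma card_classes_le : #|P| <= #|G|.
Proof. by rewrite partition_pblocks -cardsT leq_imset_card. Qed.

Lemma mem_seen A v : A \in P ->
  (A \in seen v) = [exists u in cnbhd v, u \in A].
Proof.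
move=> PA; apply/imsetP/exists_inP => [[u uv ->]|[u uv uA]].
  by exists u; rewrite ?mem_own_pblock.
by exists u; rewrite ?(def_pblock tiP PA uA).
Qed.

Lemma coalition_seen A B v : A \in P -> B \in P ->
  independent_coalition A B -> (A \in seen v) || (B \in seen v).
Proof.
move=> PA PB /and5P[_ _ _ _ /and3P[_ _ /dominatingP/(_ v)[u uv]]].
by rewrite !mem_seen // inE => /orP[] uX; apply/orP; [left|right];
  apply/exists_inP; exists u.
Qed.

Lemma partners_unseen A v : A \in P -> A \notin seen v ->
  partners A \subset seen v.
Proof.
move=> PA nAv; apply/subsetP=> X; rewrite inE => /andP[PX AX].
by move: (coalition_seen v PA PX AX); rewrite (negPf nAv).
Qed.

(** A member of a coalition is independent, so failing to be an independent
dominating set means failing to dominate. *)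
Lemma coalition_unseen A B : A \in P -> independent_coalition A B ->
  exists v, A \notin seen v.
Proof.
move=> PA /and5P[_ iA _ + _]; rewrite /independent_dominating iA /=.
case/forallPn=> v; rewrite negb_or => /andP[vA /exists_inPn nA].
exists v; rewrite mem_seen //; apply/exists_inPn=> u.
rewrite inE => /orP[/eqP->//|vu]; apply/negP=> uA.
by move: (nA u uA); rewrite vu.
Qed.

Lemma adjacent_no_coalition u v : edge u v ->
  ~~ independent_coalition (pblock P u) (pblock P v).
Proof.
move=> uv; apply/negP=> /and5P[_ _ _ _ /and3P[_ + _]].
move/forall_inP/(_ u); rewrite inE mem_own_pblock => /(_ isT).
move/forall_inP/(_ v); rewrite inE mem_own_pblock orbT => /(_ isT).
by rewrite uv.
Qed.

Hypothesis coalP : forall A, A \in P -> exists B, B \in partners A.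

Hypothesis deg2 : forall v, #|cnbhd v| <= 3.

Lemma card_seen v : #|seen v| <= 3.
Proof. exact: leq_trans (leq_imset_card _ _) (deg2 v). Qed.

Lemma class_unseen A : A \in P -> exists v, A \notin seen v.
Proof.
move=> PA; have [B] := coalP PA.
by rewrite inE => /andP[_]; apply: coalition_unseen.
Qed.

(** The shape that a leaf forces on the coalitions; it is symmetric in a and b,
which halves the counting below. *)
Definition hitting a b : Prop := [/\ a \in P, b \in P, b \notin partners a,
  a \notin partners b & P = [set a; b] :|: (partners a :|: partners b)].

Lemma hitting_sym a b : hitting a b -> hitting b a.
Proof.
case=> Pa Pb nb na eP; split=> //.
by rewrite {1}eP (setUC [set a]) (setUC (partners a)).
Qed.

(** The leaf z must be dominated by every coalition, and it sees only its own
class and the class of u; these two cannot be partners because of the edge zu. *)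
Lemma leaf_hitting z u : edge z u -> cnbhd z = [set z; u] ->
  hitting (pblock P z) (pblock P u).
Proof.
move=> zu cz; have nbr := adjacent_no_coalition zu.
split; rewrite ?pblock_in // ?inE.
- by rewrite (negPf nbr) andbF.
- by rewrite coalition_sym (negPf nbr) andbF.
apply/eqP; rewrite eqEsubset; apply/andP; split; last first.
  by apply/subsetP=> X; rewrite !inE => /orP[/orP[]/eqP->|/orP[]/andP[]//];
    rewrite pblock_in.
apply/subsetP=> X PX; have [Y] := coalP PX.
rewrite inE => /andP[PY XY]; have := coalition_seen z PX PY XY.
rewrite /seen cz imsetU1 imset_set1 !inE PX /=.
by case/orP=> /orP[]/eqP eX; move: XY; rewrite eX ?eqxx ?orbT //;
  rewrite coalition_sym => ->; rewrite ?orbT.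
Qed.

Lemma hitting_card a b : hitting a b ->
  #|P| <= 2 + #|partners a :|: partners b|.
Proof.
case=> _ _ _ _ {1}->; apply: leq_trans (leq_card_setU _ _) _.
by rewrite leq_add2r cards2; case: (a != b).
Qed.

(** A vertex seeing neither a nor b would see all the classes other than a and b.
It sees at most three, which leaves at most five classes in total. *)
Lemma hitting_unseen a b v : hitting a b -> 6 <= #|P| -> a \notin seen v ->
  b |: partners a \subset seen v.
Proof.
move=> hab P6 nav; have [Pa Pb _ _ _] := hab.
have sa := partners_unseen Pa nav.
rewrite subUset sub1set sa andbT; apply: contraLR P6 => nbv.
rewrite -ltnNge; apply: leq_ltn_trans (hitting_card hab) _.
rewrite ltnS (leq_add2l 2 _ 3); apply: leq_trans (card_seen v).
by apply: subset_leq_card; rewrite subUset sa partners_unseen.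
Qed.

Lemma hitting_partners_le2 a b : hitting a b -> 6 <= #|P| ->
  #|partners a| <= 2.
Proof.
move=> hab P6; have [Pa _ nba _ _] := hab.
have [v nav] := class_unseen Pa.
have /subset_leq_card := hitting_unseen hab P6 nav.
by rewrite cardsU1 nba => le; move: (leq_trans le (card_seen v)).
Qed.

(** The counts 6 <= 2 + |partners a| + |partners b| and |partners| <= 2 are both
tight, so all the inclusions used to derive them are equalities. *)
Lemma hitting_extremal a b : hitting a b -> 6 <= #|P| ->
  [/\ #|P| = 6, [disjoint b |: partners a & a |: partners b]
    & forall v, a \notin seen v -> seen v = b |: partners a /\ #|seen v| = 3].
Proof.
move=> hab P6; have [Pa Pb nba nab eP] := hab.
have la := hitting_partners_le2 hab P6.
have lb := hitting_partners_le2 (hitting_sym hab) P6.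
have le := hitting_card hab.
have [leU eqU] := leq_card_setU (partners a) (partners b).
have [naa nbb] : a \notin partners a /\ b \notin partners b.
  by split; rewrite inE negb_and; apply/orP; right; apply/negP=> /and5P[];
     rewrite -setI_eq0 setIid => /eqP a0; move: (partition0 partP);
     rewrite -a0 ?Pa ?Pb.
have ab : a != b.
  apply: contraTneq P6 => eab; rewrite eP eab setUid -ltnNge setUid.
  by rewrite cardsU1 nbb ltnS; exact: leq_trans lb _.
have U4 : 4 <= #|partners a :|: partners b|.
  by rewrite -(leq_add2l 2) (leq_trans P6 le).
have dN : [disjoint partners a & partners b].
  by rewrite -eqU eqn_leq leU (leq_trans (leq_add la lb) U4).
have ca : #|partners a| = 2.
  apply/eqP; rewrite eqn_leq la -(leq_add2r 2).
  by rewrite (leq_trans U4) // (leq_trans leU) // leq_add2l.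
split.
- apply/eqP; rewrite eqn_leq P6 andbT (leq_trans le) // leq_add2l.
  exact: leq_trans leU (leq_add la lb).
- rewrite !disjoints_subset in dN *.
  rewrite subUset sub1set in_setC in_setU1 negb_or eq_sym ab nbb /=.
  apply/subsetP=> X Xa; rewrite in_setC in_setU1 negb_or; apply/andP; split.
    by apply: contraNneq naa => eXa; rewrite -{1}eXa.
  by have := subsetP dN X Xa; rewrite in_setC.
- move=> v nav; have sv := hitting_unseen hab P6 nav.
  have c3 : #|b |: partners a| = 3 by rewrite cardsU1 nba ca.
  have ev : seen v = b |: partners a.
    by apply/esym/eqP; rewrite eqEcard sv c3 card_seen.
  by rewrite ev.
Qed.

End Seen.

(** * Colour sequences on a path *)

Section Window.
Variable T : eqType.
Implicit Type c : nat -> T.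

(** The colours on N[v], for the path 0, 1, ..., n-1. At an end of the path the
truncations repeat the colour of v itself, so such a window is never
duplicate-free. *)
Definition window n c v := [:: c v.-1; c v; c (minn v.+1 n.-1)].

Lemma windowE n c v :
  window n c v = [seq c j | j <- [:: v.-1; v; minn v.+1 n.-1]].
Proof. by []. Qed.

(** The conclusion of [hitting_extremal] for the class a, read along the path. *)
Definition forced n c a (S : {pred T}) := forall v, v < n ->
  a \notin window n c v -> uniq (window n c v) /\ window n c v =i S.

Lemma window_inner n c v : v.+1 < n -> window n c v = [:: c v.-1; c v; c v.+1].
Proof. by move=> vn; rewrite /window (minn_idPl _) //; lia. Qed.

Lemma pair_cover2 (a b x y : T) : a != b -> a \in [:: x; y] -> b \in [:: x; y] ->
  x \in [:: a; b] /\ y \in [:: a; b].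
Proof.
move=> ab; rewrite !inE => /orP[]/eqP ea /orP[]/eqP eb;
  by move: ab; rewrite ?ea ?eb ?eqxx ?orbT.
Qed.

Section Gap.
Variables (n : nat) (c : nat -> T).

(** A window at an end of the path has a repetition, so it must show a. *)
Lemma forced_ends a S : 2 <= n -> forced n c a S ->
  (a \in [:: c 0; c 1]) && (a \in [:: c n.-2; c n.-1]).
Proof.
move=> n2 fa; apply/andP; split.
  apply: contraT => na; have [||] := fa 0.
  - lia.
  - rewrite window_inner ?inE //=; move: na; rewrite !inE.
    by case: (a == c 0).
  - by rewrite /= inE eqxx.
have e : minn n.-1.+1 n.-1 = n.-1 by lia.
apply: contraT => na; have [||] := fa n.-1.
- lia.
- rewrite /window e !inE; move: na; rewrite !inE.
  by case: (a == c n.-1); rewrite ?orbT ?orbF.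
by rewrite /window e /= !inE eqxx /= andbF.
Qed.

(** The windows at distance one from an end contain the window of that end. *)
Lemma forced_inner a S v : 2 <= n -> forced n c a S -> v < n ->
  a \notin window n c v -> 2 <= v /\ v.+2 < n.
Proof.
move=> n2 fa vn na; have /andP[a0 an] := forced_ends n2 fa.
split; apply: contraNT na => hv.
  have [->|->] : v = 0 \/ v = 1 by lia.
    by rewrite window_inner // inE a0 orbT.
  rewrite /window !inE; move: a0; rewrite !inE.
  by case/orP=> ->; rewrite ?orbT.
have [->|->] : v = n.-1 \/ v = n.-2 by lia.
  by rewrite /window; move: an; rewrite !inE orbA => ->.
rewrite /window; have -> : minn n.-2.+1 n.-1 = n.-1 by lia.
by rewrite inE an orbT.
Qed.

(** Take v and w as close as possible. Their windows have disjoint colours, so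
w - v >= 3. Since v+1 sees a and w-1 sees b, while v and w do not, position v+2
has colour a and position w-2 has colour b; this excludes w - v = 4. If
w - v >= 5, then two vertices to the left of v and two to the right of w give
ten. If w - v = 3, then b stands at v+1, so v-1 carries a colour other than a
and b; since the first two positions carry a and b, there are three vertices to
the left of v, and by symmetry three to the right of w. *)
Lemma forced_gap_length a b (Sa Sb : {pred T}) v w : 2 <= n ->
  a != b -> (forall x, x \in Sa -> x \in Sb -> False) -> b \in Sa -> a \in Sb ->
  forced n c a Sa -> forced n c b Sb ->
  v < w -> w < n -> a \notin window n c v -> b \notin window n c w -> 10 <= n.
Proof.
move=> n2 ab dS bSa aSb fa fb.
(* Induction on w - v stands for the choice of a closest pair. *)
have [m] := ubnP (w - v); elim: m v w => // m IHm v w lem vw wn nav nbw.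
have vn : v < n by lia.
have [v2 vn3] := forced_inner n2 fa vn nav.
have [w2 wn3] := forced_inner n2 fb wn nbw.
have [uv ev] := fa _ vn nav; have [uw ew] := fb _ wn nbw.
rewrite window_inner in uv ev; last by lia.
rewrite window_inner in uw ew; last by lia.
have farP i j : i \in [:: v.-1; v; v.+1] -> j \in [:: w.-1; w; w.+1] -> i != j.
  move=> iv jw; apply/eqP=> ij; apply: (dS (c i)).
    by rewrite -ev; apply: (map_f c iv).
  by rewrite -ew ij; apply: (map_f c jw).
have gap : 3 <= w - v.
  have : v.+1 != w by apply: farP; rewrite !inE eqxx ?orbT.
  have : v.+1 != w.-1 by apply: farP; rewrite !inE eqxx ?orbT.
  lia.
have [nav1|av1] := boolP (a \notin window n c v.+1).
  by apply: (IHm v.+1 w) => //; lia.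
have [nbw1|bw1] := boolP (b \notin window n c w.-1).
  by apply: (IHm v w.-1) => //; lia.
have av2 : a = c v.+2.
  move: av1; rewrite negbK window_inner ?inE /=; last by lia.
  by case/or3P=> /eqP // ea; case/negP: nav;
    rewrite window_inner ?inE -?ea ?eqxx ?orbT //; lia.
have bw2 : b = c w.-2.
  move: bw1; rewrite negbK window_inner ?inE /=; last by lia.
  have -> : w.-1.+1 = w by lia.
  by case/or3P=> /eqP // eb; case/negP: nbw;
    rewrite window_inner ?inE -?eb ?eqxx ?orbT //; lia.
have [w3|w4|w5] : [\/ w = v.+3, w = v.+4 | v + 5 <= w].
- have [|] := boolP (v + 5 <= w); first by constructor 3.
  have [->|] := eqVneq w v.+3; first by constructor 1.
  by move=> *; constructor 2; lia.
- have bv1 : b = c v.+1 by rewrite bw2 w3.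
  have aw1 : a = c w.-1 by rewrite av2 w3.
  have /andP[a0 an] := forced_ends n2 fa.
  have /andP[b0 bn] := forced_ends n2 fb.
  have v3 : v != 2.
    apply: contraTneq (pair_cover2 ab a0 b0).2 => v2E.
    rewrite !inE negb_or; apply/andP; split.
      by apply: contraNneq nav => <-; rewrite v2E mem_head.
    move: uv; rewrite bv1 v2E /= !inE negb_or.
    by case/andP=> /andP[].
  have w3' : w.+3 != n.
    apply: contraTneq (pair_cover2 ab an bn).1 => w3E.
    have -> : n.-2 = w.+1 by lia.
    rewrite !inE negb_or; apply/andP; split; last first.
      by apply: contraNneq nbw => <-; rewrite window_inner ?inE ?eqxx ?orbT //; lia.
    rewrite aw1 eq_sym; move: uw; rewrite /= !inE negb_or.
    by case/andP=> /andP[].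
  lia.
- by move: ab; rewrite av2 bw2 w4 eqxx.
- lia.
Qed.

End Gap.
End Window.

(** * The upper bound for paths *)

Lemma in_cnbhd_path n (i j : path_graph n) :
  (j \in cnbhd i) = (val j \in [:: (val i).-1; val i; minn (val i).+1 n.-1]).
Proof.
case: i j => i ilt [j jlt]; rewrite !inE /= /path_edge -!val_eqE /=.
apply/idP/idP; lia.
Qed.

Lemma path_card_cnbhd n (v : path_graph n) : #|cnbhd v| <= 3.
Proof.
rewrite cardE -(size_map val).
apply: (@uniq_leq_size _ _ [:: (val v).-1; val v; minn (val v).+1 n.-1]).
  by rewrite map_inj_uniq ?enum_uniq //; apply: val_inj.
by move=> k /mapP[u]; rewrite mem_enum in_cnbhd_path => + ->.
Qed.

Lemma path_no_singleton n (S : {set path_graph n}) : 4 <= n ->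
  ~~ singleton_dominating S.
Proof.
case: n S => // m S n4; apply/negP=> /andP[/cards1P[x ->] /dominatingP domx].
have [u + /set1P eu] := domx ord0; have [w + /set1P ew] := domx ord_max.
rewrite eu ew !in_cnbhd_path /= !inE; lia.
Qed.

Lemma path_coalitional n (P : {set {set path_graph n}}) : 4 <= n ->
  ic_partition P ->
  partition P [set: path_graph n] /\
  (forall A, A \in P -> exists B, B \in partners P A).
Proof.
move=> n4 /andP[partP /forall_inP icP]; split=> // A PA.
move: (icP A PA); rewrite (negPf (path_no_singleton _ n4)) /=.
case/andP=> _ /exists_inP[B PB /andP[_ AB]].
by exists B; rewrite inE PB.
Qed.

Section PathUpper.
Variables (m : nat) (P : {set {set path_graph m.+1}}).
Hypothesis partP : partition P [set: path_graph m.+1].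

Definition path_class (k : nat) : {set path_graph m.+1} :=
  pblock P (inord k : 'I_m.+1).

Lemma seen_window v : v < m.+1 ->
  seen P (inord v : 'I_m.+1) =i window m.+1 path_class v.
Proof.
move=> vm X; rewrite windowE.
apply/imsetP/mapP=> [[u + ->]|[k kv ->]].
  by rewrite in_cnbhd_path /= inordK // => uv; exists (val u);
    rewrite // /path_class inord_val.
exists (inord k : 'I_m.+1) => //; rewrite in_cnbhd_path /= !inordK //.
by move: kv; rewrite !inE; lia.
Qed.

Lemma seen_window_uniq v : v < m.+1 -> #|seen P (inord v : 'I_m.+1)| = 3 ->
  uniq (window m.+1 path_class v).
Proof.
move=> vm c3; apply/card_uniqP; rewrite [RHS]/= -c3.
by apply: eq_card => X; rewrite seen_window.
Qed.

Hypothesis coalP : forall A, A \in P -> exists B, B \in partners P A.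

Lemma path_hitting : 1 <= m -> hitting P (path_class 0) (path_class 1).
Proof.
move=> m1; apply: (leaf_hitting partP coalP).
  by rewrite /= /path_edge !inordK.
apply/setP=> u; rewrite in_cnbhd_path !inE -!val_eqE /= !inordK //; lia.
Qed.

Lemma path_extremal : 3 <= m -> 6 <= #|P| -> #|P| = 6 /\ 10 <= m.+1.
Proof.
move=> m3 P6; have m1 : 1 <= m by lia.
have hab := path_hitting m1; have hba := hitting_sym hab.
have deg := @path_card_cnbhd m.+1.
have [eP dis ua] := hitting_extremal partP coalP deg hab P6.
have [_ _ ub] := hitting_extremal partP coalP deg hba P6.
split=> //.
have [Pa Pb nba _ _] := hab.
have forcedP a b : (forall v, a \notin seen P v ->
    seen P v = b |: partners P a /\ #|seen P v| = 3) ->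
    forced m.+1 path_class a (mem (b |: partners P a)).
  move=> uA v vm; rewrite -seen_window // => /uA[ev c3].
  by split=> [|X]; [exact: seen_window_uniq | rewrite -seen_window // ev].
set a := path_class 0 in hab hba dis ua ub Pa Pb nba *.
set b := path_class 1 in hab hba dis ua ub Pa Pb nba *.
have fa := forcedP _ _ ua; have fb := forcedP _ _ ub.
have aS : a \in a |: partners P b by rewrite in_setU1 eqxx.
have bS : b \in b |: partners P a by rewrite in_setU1 eqxx.
have dS X : X \in b |: partners P a -> X \in a |: partners P b -> False.
  by move=> Xb Xa; move: (disjointFr dis Xb); rewrite Xa.
have ab : a != b by apply/eqP=> eab; apply: (dS a); rewrite // {1}eab.
have [v] := class_unseen partP coalP Pa; have [w] := class_unseen partP coalP Pb.
rewrite -[w]inord_val -[v]inord_val !seen_window // => nbw nav.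
have m2 : 2 <= m.+1 by lia.
have [vw|wv|vw] := ltngtP (val v) (val w).
- exact: (forced_gap_length m2 ab dS bS aS fa fb vw (ltn_ord w) nav nbw).
- apply: (forced_gap_length m2 _ _ aS bS fb fa wv (ltn_ord v) nbw nav).
    by rewrite eq_sym.
  by move=> X Xa Xb; apply: dS Xb Xa.
move: nbw; rewrite -vw; have [_ ->] := fa _ (ltn_ord v) nav.
by case/negP.
Qed.

(** With five classes on five vertices, distinct vertices have distinct classes.
The partner of the class of the middle vertex would have to be seen by both
ends, but these see disjoint sets of classes. *)
Lemma path5_card : m = 4 -> #|P| <= 4.
Proof.
move=> m4; rewrite leqNgt; apply/negP=> P5.
have m5 : m.+1 <= #|P| by rewrite (leq_trans _ P5) // m4.
have inj : {in gtn m.+1 &, injective path_class}.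
  have /imset_injP inj : #|pblock P @: [set: path_graph m.+1]| ==
     #|[set: path_graph m.+1]|.
    by rewrite -partition_pblocks // cardsT eqn_leq card_classes_le //= card_ord.
  move=> i j im jm /inj; rewrite !inE => /(_ isT isT) /(congr1 val) /=.
  by rewrite !inordK.
have [D] := coalP (pblock_in partP (inord 2)).
rewrite inE => /andP[PD cD].
have c2 := pblock_in partP (inord 2).
have := coalition_seen partP (inord 4) c2 PD cD.
have := coalition_seen partP (inord 0) c2 PD cD.
have eqC i j : i < 5 -> j < 5 -> (path_class i == path_class j) = (i == j).
  by move=> i5 j5; apply: (inj_in_eq inj); rewrite inE m4.
rewrite !seen_window ?m4 // -/(path_class 2) !inE.
have -> : minn 1 m.+1.-1 = 1 by rewrite m4.
have -> : minn 5 m.+1.-1 = 4 by rewrite m4.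
rewrite /= !eqC //= orbA orbb.
by case/orP=> /eqP->; rewrite !eqC.
Qed.

End PathUpper.

Lemma path_ic_le n (P : {set {set path_graph n}}) : 1 <= n -> ic_partition P ->
  #|P| <= (if n <= 4 then n else if n == 5 then 4 else if n <= 9 then 5 else 6).
Proof.
case: n P => // m P _ icP.
have [n4|n4] := leqP m.+1 4.
  by case/andP: icP => /card_classes_le + _; rewrite card_ord.
have m3 : 3 <= m by lia.
have [partP coalP] := path_coalitional (ltnW n4) icP.
have [/eqP n5|n5] := ifP; first by apply: path5_card => //; lia.
have ext := path_extremal partP coalP m3.
have [n9|n9] := leqP m.+1 9; rewrite leqNgt; apply/negP=> P6.
  by have [_] := ext P6; lia.
by have [] := ext (ltnW P6); lia.
Qed.

(** * Colourings that give the lower bound *)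

Section Colouring.
Variables (n k : nat) (c : nat -> nat).

(** Domination and independence of the set of vertices with colour in S, as
boolean tests on the colour sequence, so that they can be checked by computation
for a given word. *)
Definition covered (S : seq nat) :=
  all (fun v => has (mem S) (window n c v)) (iota 0 n).

Definition separated (S : seq nat) :=
  all (fun i => ~~ ((c i \in S) && (c i.+1 \in S))) (iota 0 n.-1).

Definition paired x := ~~ covered [:: x] && has (fun y =>
  [&& y != x, separated [:: x; y], ~~ covered [:: y] & covered [:: x; y]])
  (iota 0 k).

Definition alone x := (count (fun i => c i == x) (iota 0 n) == 1) && covered [:: x].

Definition onto_colours := all (fun i => c i < k) (iota 0 n) &&
  all (mem (mkseq c n)) (iota 0 k).

Definition colour_class (S : seq nat) : {set path_graph n} :=
  [set i : 'I_n | c i \in S].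

Lemma dominating_covered S : dominating (colour_class S) = covered S.
Proof.
apply/dominatingP/allP => [domS v|covS v].
  rewrite mem_iota add0n => vn; have [u] := domS (Ordinal vn).
  rewrite in_cnbhd_path in_set => uv uS; apply/hasP.
  by exists (c u); [rewrite windowE; apply: map_f | apply: uS].
case: v => i ilt; have /hasP[x] : has (mem S) (window n c i).
  by apply: covS; rewrite mem_iota /=.
rewrite windowE => /mapP[j ji ->] cjS; have jn : j < n.
  by move: ji; rewrite !inE; lia.
by exists (Ordinal jn); rewrite ?in_cnbhd_path // inE.
Qed.

Lemma independent_separated S : separated S -> independent (colour_class S).
Proof.
move=> /allP sepS; apply/forall_inP=> u; rewrite inE => uS.
apply/forall_inP=> v; rewrite inE => vS; apply/negP.
case/orP=> /eqP e; [have := sepS u | have := sepS v];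
  rewrite e uS vS mem_iota /= => /(_ _)/negP; apply; rewrite //.
  by move: (ltn_ord v) e; lia.
by move: (ltn_ord u) e; lia.
Qed.

Lemma separated_sub S S' : {subset S <= S'} -> separated S' -> separated S.
Proof.
move=> sS /allP sep; apply/allP=> i /sep; apply: contra.
by case/andP=> /sS-> /sS->.
Qed.

Lemma paired_coalition x : paired x ->
  ~~ independent_dominating (colour_class [:: x]) /\ exists y, [/\ y < k, y != x &
    independent_coalition (colour_class [:: x]) (colour_class [:: y])].
Proof.
case/andP=> ncx /hasP[y]; rewrite mem_iota /= => yk /and4P[yx sep ncy cxy].
have nidS z : ~~ covered [:: z] ->
    ~~ independent_dominating (colour_class [:: z]).
  by move=> ncz; rewrite /independent_dominating dominating_covered (negPf ncz) andbF.
split; first exact: nidS.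
exists y; split=> //; apply/and5P; split; rewrite ?nidS //.
- rewrite -setI_eq0; apply/eqP/setP=> i; rewrite !inE.
  by apply/negP=> /andP[/eqP-> xy]; move: yx; rewrite eq_sym xy.
- apply: independent_separated; apply: separated_sub sep.
  by move=> z; rewrite !inE => ->.
- apply: independent_separated; apply: separated_sub sep.
  by move=> z; rewrite !inE => ->; rewrite orbT.
have -> : colour_class [:: x] :|: colour_class [:: y] = colour_class [:: x; y].
  by apply/setP=> i; rewrite !inE.
by rewrite /= /independent_dominating independent_separated // dominating_covered.
Qed.

Lemma alone_singleton x : alone x -> singleton_dominating (colour_class [:: x]).
Proof.
case/andP=> /eqP cx covx; rewrite /singleton_dominating dominating_covered covx.
rewrite andbT -cx.
have -> : iota 0 n = index_iota 0 n by rewrite /index_iota subn0.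
rewrite -sum1_count big_mkord sum1_card.
by apply/eqP/eq_card => i; rewrite inE mem_seq1.
Qed.

Definition colour_classes : {set {set path_graph n}} :=
  [set colour_class [:: val x] | x : 'I_k].

Lemma colour_classes_ic : onto_colours ->
  all (fun x => alone x || paired x) (iota 0 k) ->
  ic_partition colour_classes /\ #|colour_classes| = k.
Proof.
case/andP=> /allP ck /allP onto /allP good.
have rep x : x < k -> exists i : 'I_n, c i = x.
  move=> xk; have /mapP[i] : x \in mkseq c n by apply: onto; rewrite mem_iota.
  by rewrite mem_iota /= => lt ->; exists (Ordinal lt).
have inj : injective (fun x : 'I_k => colour_class [:: val x]).
  move=> x y /setP exy; have [i ci] := rep x (ltn_ord x).
  by move: (exy i); rewrite !inE ci eqxx => /esym/eqP/val_inj.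
split; last by rewrite card_imset // card_ord.
apply/andP; split; last first.
  apply/forall_inP=> A /imsetP[x _ ->].
  have /orP[/alone_singleton->//|/paired_coalition[-> [y [yk yx xy]]]] :
    alone x || paired x by apply: good; rewrite mem_iota /=.
  apply/orP; right; apply/exists_inP; exists (colour_class [:: y]).
    by apply/imsetP; exists (Ordinal yk).
  by rewrite xy andbT; apply: contra yx => /eqP/(inj (Ordinal yk) x) <-.
apply/and3P; split.
- apply/eqP/setP=> i; rewrite inE; apply/bigcupP.
  have cik : c i < k by apply: ck; rewrite mem_iota /=.
  exists (colour_class [:: c i]); last by rewrite !inE.
  by apply/imsetP; exists (Ordinal cik).
- apply/trivIsetP=> _ _ /imsetP[x _ ->] /imsetP[y _ ->] neq.
  rewrite -setI_eq0; apply: contraNT neq => /set0Pn[i].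
  by rewrite !inE => /andP[/eqP<- /eqP<-].
apply/imsetP=> -[x _ /esym/setP e0]; have [i ci] := rep x (ltn_ord x).
by move: (e0 i); rewrite !inE ci eqxx.
Qed.

End Colouring.

(** The word c with its second letter repeated in front: xyz... becomes
yxyz... *)
Definition zigzag (c : nat -> nat) i := if i is j.+1 then c j else c 1.

Section Zigzag.
Variables (n k : nat) (c : nat -> nat).
Hypothesis n2 : 2 <= n.

Lemma all_iotaS (p : pred nat) m :
  all p (iota 0 m.+1) = p 0 && all (fun i => p i.+1) (iota 0 m).
Proof. by rewrite /= (iotaDl 1 0) all_map. Qed.

(** The windows of the longer word at 0 and 1 show the same colours as the old
window at 0; all the other windows are unchanged. *)
Lemma covered_zigzag S : covered n.+1 (zigzag c) S = covered n c S.
Proof.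
rewrite /covered all_iotaS.
have -> : all (fun v => has (mem S) (window n.+1 (zigzag c) v.+1)) (iota 0 n) =
  all (fun v => has (mem S) (window n c v)) (iota 0 n).
  apply: eq_in_all => -[|v]; rewrite mem_iota add0n /window.
    have -> : minn 2 n.+1.-1 = 2 by lia.
    have -> : minn 1 n.-1 = 1 by lia.
    by move=> _ /=; case: (c 0 \in S); case: (c 1 \in S).
  by move=> vn; have -> : minn v.+3 n.+1.-1 = (minn v.+2 n.-1).+1 by lia.
apply: andb_idl => /allP/(_ 0); rewrite mem_iota add0n /window.
have -> : minn 1 n.+1.-1 = 1 by lia.
have -> : minn 1 n.-1 = 1 by lia.
move=> /(_ (ltnW n2)) /=.
by case: (c 0 \in S); case: (c 1 \in S).
Qed.

(** The only new edge carries the same two colours as the edge after it. *)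
Lemma separated_zigzag S : separated n.+1 (zigzag c) S = separated n c S.
Proof.
rewrite /separated; have -> : n.+1.-1 = n.-1.+1 by lia.
rewrite all_iotaS; apply: andb_idl => /allP/(_ 0).
by rewrite mem_iota /= andbC; apply; lia.
Qed.

Lemma paired_zigzag x : paired n.+1 k (zigzag c) x = paired n k c x.
Proof.
rewrite /paired covered_zigzag; congr (_ && _); apply: eq_has => y.
by rewrite !covered_zigzag separated_zigzag.
Qed.

Lemma onto_zigzag : onto_colours n k c -> onto_colours n.+1 k (zigzag c).
Proof.
case/andP=> /allP ck /allP onto; apply/andP; split.
  rewrite all_iotaS; apply/andP; split; last exact/allP.
  by apply: ck; rewrite mem_iota.
apply/allP=> x /onto/mapP[i]; rewrite mem_iota /= => lt ->.
by apply/mapP; exists i.+1; rewrite ?mem_iota.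
Qed.

End Zigzag.

Lemma zigzag_paired n0 k c n : 2 <= n0 -> n0 <= n ->
  onto_colours n0 k c -> all (paired n0 k c) (iota 0 k) ->
  exists c', onto_colours n k c' /\ all (paired n k c') (iota 0 k).
Proof.
move=> n02 le onto pair; elim: n le => [|n IHn]; first by lia.
rewrite leq_eqVlt => /orP[/eqP <-|le]; first by exists c.
have [c' [ontoc' pairc']] := IHn le; have n2 := leq_trans n02 le.
exists (zigzag c'); split; first exact: onto_zigzag.
by rewrite (eq_all (paired_zigzag k c' n2)).
Qed.

Lemma path_ic_ge n : 1 <= n -> exists2 P, @ic_partition (path_graph n) P &
  #|P| = (if n <= 4 then n else if n == 5 then 4 else if n <= 9 then 5 else 6).
Proof.
move=> n1.
have from k c : onto_colours n k c ->
    all (fun x => alone n c x || paired n k c x) (iota 0 k) ->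
    exists2 P, @ic_partition (path_graph n) P & #|P| = k.
  by move=> onto good; exists (colour_classes n k c);
    have [] := colour_classes_ic onto good.
have extend n0 k c : 2 <= n0 -> n0 <= n ->
    onto_colours n0 k c -> all (paired n0 k c) (iota 0 k) ->
    exists2 P, @ic_partition (path_graph n) P & #|P| = k.
  move=> n02 le onto pair; have [c' [onto' pair']] := zigzag_paired n02 le onto pair.
  apply: (from k c' onto'); apply: sub_all pair' => x ->.
  by rewrite orbT.
have [n3|n4] := leqP n 3.
  rewrite (leq_trans n3) //; apply: (from n id).
    by case: n n1 n3 {from extend} => [|[|[|[|n]]]].
  by case: n n1 n3 {from extend} => [|[|[|[|n]]]].
have [n5|n6] := leqP n 5.
  have -> : (if n <= 4 then n else if n == 5 then 4 else if n <= 9 then 5 else 6) = 4.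
    by have [->|->] : n = 4 \/ n = 5 by lia.
  exact: (extend 4 4 id).
have -> : (n <= 4) = false by lia.
have -> : (n == 5) = false by lia.
have [n9|n10] := leqP n 9.
  exact: (extend 6 5 (nth 0 [:: 0; 1; 2; 3; 4; 0])).
exact: (extend 10 6 (nth 0 [:: 0; 1; 2; 3; 1; 0; 4; 5; 0; 1])).
Qed.

Theorem theorem3p6 (n : nat) (n_ge1 : 1 <= n) :
  IC_is (path_graph n)
    (if n <= 4 then n
     else if n == 5 then 4
     else if n <= 9 then 5
     else 6).
Proof. by split=> [|P]; [exact: path_ic_ge | exact: path_ic_le]. Qed.
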